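(* Let $n,k\ge 0$ be integers. If $n\ge k$, then the number $M_{n,k}(n)$ of merging paths from $(0,0)$ ending at the diagonal point $(n,n)$ whose arrival sequence has exactly $k$ zeros is $$M_{n,k}(n)=\binom{2n}{k}-\binom{2n}{k-1}.$$
   Context: An arrival sequence of length $\ell$ is a binary string $\mathbf{b}=b_1b_2\cdots b_\ell\in\{0,1\}^\ell$. Cars $1,2,\dots,\ell$ arrive in order and choose between two initially empty lanes (left and right): if $b_i=0$, car $i$ enters the right lane; if $b_i=1$, car $i$ enters the currently shorter lane, and enters the right lane if both lanes have the same length (this last event is called a bounce). The merging path of $\mathbf{b}$ is the lattice path from $(0,0)$ whose $i$-th step is an up step $(0,1)$ if car $i$ enters the right lane (decorated if it is a bounce) and a right step $(1,0)$ if car $i$ enters the left lane; merging paths are in bijection with arrival sequences. It ends at $(n,m)$ when $n$ cars are in the left lane and $m$ are in the right lane, $m+n=\ell$. $M_{n,k}(m)$ is the number of arrival sequences of length $m+n$ with exactly $k$ zeros whose merging path ends at $(n,m)$. Binomial coefficients with negative lower index are $0$. *)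

(* Defs.v *)
From mathcomp Require Import all_boot all_order all_algebra.
Set Implicit Arguments.
Unset Strict Implicit.
Unset Printing Implicit Defensive.

(* [UpStep d] is the step (0,1), decorated when [d] is true; [RightStep] is
   the step (1,0). *)
Inductive step := UpStep of bool | RightStep.

Definition move (p : nat * nat) (s : step) : nat * nat :=
  match s with
  | UpStep _ => (p.1, p.2.+1)
  | RightStep => (p.1.+1, p.2)
  end.

(* A position [p] of the path is also the pair of lane lengths: [p.1] cars in
   the left lane and [p.2] in the right lane. *)
Definition car_step (p : nat * nat) (b : bool) : step :=
  if b then
    if p.1 < p.2 then RightStep
    else if p.1 == p.2 then UpStep true
    else UpStep false
  else UpStep false.

(* An arrival sequence is a sequence of booleans, [true] standing for 1. *)
Fixpoint merging_path_from (p : nat * nat) (b : seq bool) : seq step :=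
  if b is c :: b' then
    let s := car_step p c in s :: merging_path_from (move p s) b'
  else [::].

Definition merging_path (b : seq bool) : seq step :=
  merging_path_from (0, 0) b.

Definition path_end (w : seq step) : nat * nat := foldl move (0, 0) w.

(* M_{n,k}(m) *)
Definition merging_number (n k m : nat) : nat :=
  #|[set b : (m + n).-tuple bool |
      (count_mem false b == k) && (path_end (merging_path b) == (n, m))]|.

(* Binomial coefficient with an integer lower index, zero when negative. *)
Definition binomz (n : nat) (k : int) : int :=
  match k with
  | Posz j => Posz 'C(n, j)
  | Negz _ => 0%R
  end.

(* Main.v *)
Require Import Defs.
From mathcomp Require Import all_boot all_order all_algebra.
From mathcomp Require Import zify.

(** Count the arrival sequences of length [L] with [k] zeros that bring the
    lanes from a difference [d] (right minus left) to equal lengths. Since a 0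
    increases the difference by one and a 1 decreases it by one, except at 0
    where it increases it, conditioning on the first car gives Pascal's rule
    for the pair [(k, d)]. The solution, when [L - d - 2k] is even and
    nonnegative, is [C(L,k) - C(L,k-1)], which does not depend on [d]. The only
    delicate case is a bounce that makes [L - d - 2k] negative: then there is
    no such sequence, and the formula also vanishes since then
    [C(2k-1,k) = C(2k-1,k-1)]. *)

Definition end_from (p : nat * nat) (b : seq bool) : nat * nat :=
  foldl move p (merging_path_from p b).

(** The end point is left free: [p] and [L] determine it once the lanes are equal. *)
Definition diag_number (L : nat) (p : nat * nat) (k : nat) : nat :=
  #|[set b : L.-tuple bool |
      (count_mem false b == k) &&
      ((end_from p b).1 == (end_from p b).2)]|.

Lemma card_bool_tupleS (L : nat) (P : pred (seq bool)) :
  #|[set b : L.+1.-tuple bool | P b]| =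
  #|[set b : L.-tuple bool | P (true :: b)]| +
  #|[set b : L.-tuple bool | P (false :: b)]|.
Proof.
rewrite -!sum1dep_card.
rewrite (reindex (fun x : bool * L.-tuple bool => [tuple of x.1 :: x.2])) /=.
  rewrite -(pair_big_dep xpredT (fun c (t : L.-tuple bool) => P (c :: t))
             (fun _ _ => 1)) /=.
  by rewrite big_bool.
exists (fun t : L.+1.-tuple bool => (thead t, [tuple of behead t])).
  by move=> [c t] _; congr (_, _); apply: val_inj.
by move=> t _; rewrite [RHS]tuple_eta; apply: val_inj.
Qed.

Lemma end_from_sum (b : seq bool) (p : nat * nat) :
  (end_from p b).1 + (end_from p b).2 = p.1 + p.2 + size b.
Proof.
rewrite /end_from; elim: b p => [|c b IHb] p /=; first by rewrite addn0.
by rewrite IHb /car_step; case: c; do ?case: ifP => _; rewrite /=; lia.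
Qed.

Lemma diag_number0 (p : nat * nat) (k : nat) :
  diag_number 0 p k = ((k == 0) && (p.1 == p.2)).
Proof.
transitivity #|[pred b : 0.-tuple bool | (k == 0) && (p.1 == p.2)]|.
  by apply: eq_card => b; rewrite !inE (tuple0 b) [in RHS]eq_sym.
case: (_ && _); first by rewrite (card_tuple 0 bool).
by apply: eq_card0 => b; rewrite inE.
Qed.

Lemma diag_numberS (L : nat) (p : nat * nat) (k : nat) :
  diag_number L.+1 p k =
  diag_number L (move p (car_step p true)) k +
  (if k is k'.+1 then diag_number L (move p (car_step p false)) k' else 0).
Proof.
rewrite /diag_number
  (@card_bool_tupleS L (fun b => (count_mem false b == k) &&
     ((end_from p b).1 == (end_from p b).2))); congr (_ + _).
case: k => [|k]; last by [].
by apply: eq_card0 => b; rewrite inE.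
Qed.

Lemma diag_number_bounce (L a k : nat) :
  diag_number L.+1 (a, a) k =
  diag_number L (a, a + 1) k +
  (if k is k'.+1 then diag_number L (a, a + 1) k' else 0).
Proof. by rewrite diag_numberS /= ltnn eqxx /= addn1. Qed.

Lemma diag_number_nobounce (L a d k : nat) :
  diag_number L.+1 (a, a + d.+1) k =
  diag_number L (a.+1, a.+1 + d) k +
  (if k is k'.+1 then diag_number L (a, a + d.+2) k' else 0).
Proof.
by rewrite diag_numberS /= addnS ltnS leq_addr /= addSn !addnS.
Qed.

(** Closing the gap takes at least [d + k] ones, since each of the [k] zeros widens it by one. *)
Lemma diag_number_eq0 (L a d k : nat) :
  L < d + 2 * k -> diag_number L (a, a + d) k = 0.
Proof.
elim: L a d k => [|L IHL] a d k lt_L.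
  by rewrite diag_number0 /=; case: eqP; case: eqP => //=; lia.
case: d lt_L => [|d] lt_L.
  rewrite addn0 diag_number_bounce IHL; last by lia.
  by case: k lt_L => [|k] lt_L //; rewrite IHL //; lia.
rewrite diag_number_nobounce IHL; last by lia.
by case: k lt_L => [|k] lt_L //; rewrite IHL //; lia.
Qed.

(* By Pascal's rule ['C(L.+1, k) - 'C(L, k)] is ['C(L, k - 1)], with value 0
   at [k = 0]; this form avoids both subtractions. *)
Lemma diag_number_bin (L a d k j : nat) :
  L = d + 2 * k + 2 * j ->
  diag_number L (a, a + d) k + 'C(L.+1, k) = 2 * 'C(L, k).
Proof.
elim: L a d k j => [|L IHL] a d k j eqL.
  have [-> ->] : d = 0 /\ k = 0 by lia.
  by rewrite diag_number0 /= addn0 eqxx !bin0.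
case: d eqL => [|d] eqL.
  rewrite addn0 diag_number_bounce.
  case: k eqL => [|k] eqL.
    (* A bounce widens the gap without using a zero, so [j] drops by one; here [j > 0] as
       [L.+1 = 2 * j]. *)
    have := IHL a 1 0 j.-1; rewrite !bin0; lia.
  have E1 := IHL a 1 k j; rewrite (binS L.+1) (binS L).
  case: j eqL E1 => [|j] eqL E1; last first.
    by have := IHL a 1 k.+1 j; rewrite (binS L); lia.
  (* With [j = 0], [L = 2 * k + 1]: no sequence starts with a bounce, and [k], [k.+1] are the two
     central indices. *)
  rewrite (@diag_number_eq0 L a 1 k.+1); last by lia.
  have : 'C(L, k.+1) = 'C(L, k).
    by rewrite -(@bin_sub L k); [congr 'C(_, _); lia | lia].
  lia.
rewrite diag_number_nobounce.
case: k eqL => [|k] eqL.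
  by have := IHL a.+1 d 0 j; rewrite !bin0; lia.
have := IHL a d.+2 k j; have := IHL a.+1 d k.+1 j.
by rewrite (binS L.+1) (binS L); lia.
Qed.

Lemma merging_number_diag (n k : nat) :
  merging_number n k n = diag_number (n + n) (0, 0) k.
Proof.
apply: eq_card => b; rewrite !inE; congr (_ && _).
have := end_from_sum b (0, 0); rewrite size_tuple /path_end /merging_path.
rewrite -/(end_from (0, 0) b); case: (end_from _ _) => x y /= eq_xy.
by rewrite xpair_eqE; lia.
Qed.

Theorem corollary4p6 (n k : nat) (hkn : k <= n) :
  (Posz (merging_number n k n) =
     binomz (2 * n)%N (Posz k) - binomz (2 * n)%N (Posz k - 1))%R.
Proof.
(* [j = n - k] solves [2 * n = 2 * k + 2 * j], by [k <= n]. *)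
have := @diag_number_bin (n + n) 0 0 k (n - k).
rewrite addn0 -merging_number_diag addnn -mul2n => /(_ ltac:(lia)).
case: k hkn => [|k] hkn; first by rewrite /= !bin0; lia.
have -> : (Posz k.+1 - 1 = Posz k)%R by lia.
by rewrite binS /=; lia.
Qed.
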